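(* Let $\mathcal{G}=(\mathcal{V},\mathcal{E})$ be a finite graph with $\mathcal{E}\subseteq\mathcal{V}\times\mathcal{V}$ and $(i,i)\in\mathcal{E}$ for all $i\in\mathcal{V}$, and let ''$\rightarrow$'' be a system on $\mathcal{V}$ (as defined in the context) which is linear, local and invariant. Suppose that every trajectory converges to a distribution $\Pi$, i.e. $X_0\overset{+\infty}{\rightarrow}\Pi$ for all initial distributions $X_0$, and let $\tau$ be a time step such that $\|X_t-\Pi\|_1\le 1/2$ for all $t\ge\tau$ and all initial distributions $X_0$. Then $$\tau\ \ge\ \frac{1}{8\Phi},$$ where $\Phi$ is the conductance of $\mathcal{G}$ with respect to $\Pi$ defined in the context.
   Context: States are probability distributions $X$ on $\mathcal{V}$ (viewed as column vectors in $\mathbb{R}^{|\mathcal{V}|}$). For $\mathcal{W}\subseteq\mathcal{V}$, $X(\mathcal{W})=\sum_{i\in\mathcal{W}}X(i)$, and $X|\mathcal{W}$ denotes $X$ conditioned on $\mathcal{W}$ (i.e. $X(i)/X(\mathcal{W})$ for $i\in\mathcal{W}$, $0$ otherwise). The neighborhood $\mathcal{N}(\mathcal{W})$ is the set of nodes $i\notin\mathcal{W}$ such that $(i,j)\in\mathcal{E}$ for some $j\in\mathcal{W}$. A system ''$\rightarrow$'' assigns to each initial distribution $X_0$ and each time $t\ge 0$ a distribution $X_t$, written $X_0\overset{t}{\rightarrow}X_t$. It is: (linear) if whenever $X_0\overset{t}{\rightarrow}X_t$ and $\tilde X_0\overset{t}{\rightarrow}\tilde X_t$ and $p\in[0,1]$,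 then $pX_0+(1-p)\tilde X_0\overset{t}{\rightarrow}pX_t+(1-p)\tilde X_t$; (local) if for all $X_0$, all $t\ge0$ and all $\mathcal{W}\subseteq\mathcal{V}$, $X_{t+1}(\mathcal{W})\le X_t(\mathcal{W})+X_t(\mathcal{N}(\mathcal{W}))$; (invariant) if, whenever $X_0\overset{+\infty}{\rightarrow}\Pi$ for all $X_0$ (all trajectories converge to $\Pi$), then $\Pi\overset{t}{\rightarrow}\Pi$ for all $t$. A stochastic matrix $P$ (nonnegative, columns summing to one, acting as $X\mapsto P X$) is called local if the system $X_0\overset{t}{\rightarrow}P^tX_0$ is local. The conductance is $\Phi=\max_P\Phi(P)$, the maximum over all local stochastic matrices $P$ with $P\Pi=\Pi$, where $\Phi(P)=\min\{\,[P(\Pi|\mathcal{W})](\mathcal{V}\setminus\mathcal{W}) : \mathcal{W}\subseteq\mathcal{V},\ 0<\Pi(\mathcal{W})\le 1/2\,\}$. *)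

(* Defs.v *)
From HB Require Import structures.
From mathcomp Require Import all_boot all_order all_algebra.
From mathcomp Require Import all_classical all_reals all_analysis.

Set Implicit Arguments.
Unset Strict Implicit.
Unset Printing Implicit Defensive.

Import Order.TTheory GRing.Theory Num.Theory.
Import numFieldNormedType.Exports.

Local Open Scope classical_set_scope.
Local Open Scope ring_scope.

(* A vector indexed by the nodes is a column vector of size #|V|, the node i
   being identified with its rank in the enumeration of V. *)
Definition coord (R : realType) (V : finType) (X : 'cV[R]_#|V|) (i : V) : R :=
  X (enum_rank i) ord0.

Definition mass (R : realType) (V : finType) (X : 'cV[R]_#|V|) (W : {set V}) :
  R := \sum_(i in W) coord X i.

Definition is_dist (R : realType) (V : finType) (X : 'cV[R]_#|V|) : Prop :=
  (forall i, 0 <= coord X i) /\ mass X [set: V] = 1.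

(* X | W *)
Definition cond_dist (R : realType) (V : finType) (X : 'cV[R]_#|V|)
    (W : {set V}) : 'cV[R]_#|V| :=
  \col_k (if enum_val k \in W then X k ord0 / mass X W else 0).

Definition l1_norm (R : realType) (V : finType) (X : 'cV[R]_#|V|) : R :=
  \sum_i `|coord X i|.

Definition neighborhood (V : finType) (E : rel V) (W : {set V}) : {set V} :=
  [set i | (i \notin W) && [exists j in W, E i j]].

Definition sys (R : realType) (V : finType) : Type :=
  'cV[R]_#|V| -> nat -> 'cV[R]_#|V|.

(* [S X0 t] is the state reached at time t from the initial state X0; its value
   is only constrained when X0 is a distribution. *)
Definition is_system (R : realType) (V : finType) (S : sys R V) : Prop :=
  forall X0, is_dist X0 -> S X0 0%N = X0 /\ forall t, is_dist (S X0 t).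

Definition linear_system (R : realType) (V : finType) (S : sys R V) : Prop :=
  forall (X0 Y0 : 'cV[R]_#|V|) (t : nat) (p : R),
    is_dist X0 -> is_dist Y0 -> 0 <= p <= 1 ->
    S (p *: X0 + (1 - p) *: Y0) t = p *: S X0 t + (1 - p) *: S Y0 t.

Definition local_system (R : realType) (V : finType) (E : rel V)
    (S : sys R V) : Prop :=
  forall (X0 : 'cV[R]_#|V|) (t : nat) (W : {set V}), is_dist X0 ->
    mass (S X0 t.+1) W <= mass (S X0 t) W + mass (S X0 t) (neighborhood E W).

Definition converges_to (R : realType) (V : finType) (S : sys R V)
    (Pi : 'cV[R]_#|V|) : Prop :=
  forall X0, is_dist X0 -> S X0 t @[t --> \oo] --> Pi.

Definition invariant_system (R : realType) (V : finType) (S : sys R V) : Prop :=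
  forall Pi, is_dist Pi -> converges_to S Pi -> forall t, S Pi t = Pi.

Definition stochastic (R : realType) (n : nat) (P : 'M[R]_n) : Prop :=
  (forall i j, 0 <= P i j) /\ (forall j, \sum_i P i j = 1).

Definition matrix_system (R : realType) (V : finType) (P : 'M[R]_#|V|) :
  sys R V := fun X0 t => P ^+ t *m X0.

Definition local_matrix (R : realType) (V : finType) (E : rel V)
    (P : 'M[R]_#|V|) : Prop := local_system E (matrix_system P).

(* Phi(P); the minimum over the empty family of sets W is +oo, which occurs
   exactly when Pi is concentrated on a single node. *)
Definition conductance_of (R : realType) (V : finType) (Pi : 'cV[R]_#|V|)
    (P : 'M[R]_#|V|) : \bar R :=
  \big[Order.min/+oo%E]_(W : {set V} | 0 < mass Pi W <= 2^-1)
    (mass (P *m cond_dist Pi W) (~: W))%:E.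

Definition admissible (R : realType) (V : finType) (E : rel V)
    (Pi : 'cV[R]_#|V|) (P : 'M[R]_#|V|) : Prop :=
  [/\ stochastic P, local_matrix E P & P *m Pi = Pi].

(* The supremum is attained, i.e. it is a maximum: see [conductance_max]. *)
Definition conductance (R : realType) (V : finType) (E : rel V)
    (Pi : 'cV[R]_#|V|) : \bar R :=
  ereal_sup [set conductance_of Pi P | P in [set P | admissible E Pi P]].

(* The admissible matrices form a nonempty compact set, on which Phi(P) is
   continuous (or identically +oo). *)
Section conductance_max.
Variables (R : realType) (V : finType) (E : rel V) (Pi : 'cV[R]_#|V|).
Local Notation n := #|V|.
Local Notation row := 'rV[R]_(n * n).

Let cont_sum (I : Type) (r : seq I) (Q : pred I)
    (f : I -> row -> R) : (forall i, continuous (f i)) ->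
  continuous (fun x => \sum_(i <- r | Q i) f i x).
Proof.
move=> cf; elim: r => [|i r IH].
  under eq_fun do rewrite big_nil; exact: cst_continuous.
under eq_fun do rewrite big_cons.
by case: (Q i) => // x; exact: (cvgD (cf i x) (IH x)).
Qed.

Let cont_entry i j : continuous (fun v : row => vec_mx v i j).
Proof.
by under eq_fun do rewrite mxE; move=> x; exact: coord_continuous.
Qed.

Let cont_mulmx (p q r : nat) (f : row -> 'M[R]_(p, q)) (g : row -> 'M[R]_(q, r))
    i k : (forall i j, continuous (fun v => f v i j)) ->
  (forall i j, continuous (fun v => g v i j)) ->
  continuous (fun v => (f v *m g v) i k).
Proof.
move=> cf cg; under eq_fun do rewrite mxE.
by apply: cont_sum => j x; exact: (cvgM (cf i j x) (cg j k x)).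
Qed.

Let cont_exp t i j : continuous (fun v : row => (vec_mx v ^+ t) i j).
Proof.
elim: t i j => [|t IH] i j.
  by under eq_fun do rewrite expr0; exact: cst_continuous.
under eq_fun do rewrite exprS.
exact: cont_mulmx.
Qed.

Let cont_mass (f : row -> 'cV[R]_n) W :
  (forall i j, continuous (fun v => f v i j)) ->
  continuous (fun v => mass (f v) W).
Proof. by move=> cf; apply: cont_sum => i; exact: cf. Qed.

Let cont_cst_mx (p q : nat) (A : 'M[R]_(p, q)) i j :
  continuous (fun _ : row => A i j).
Proof. exact: cst_continuous. Qed.

Let cont_mass_exp t X W : continuous (fun v : row => mass (vec_mx v ^+ t *m X) W).
Proof.
by apply: cont_mass => i j; apply: cont_mulmx; [exact: cont_exp|exact: cont_cst_mx].
Qed.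

Let closed_le_cont (f g : row -> R) : continuous f -> continuous g ->
  closed [set v | f v <= g v].
Proof.
move=> cf cg; rewrite (_ : [set _ | _] = (fun v => g v - f v) @^-1` [set x | 0 <= x]).
  by apply: preimage_closed; [move=> x _; exact: (cvgB (cg x) (cf x))|exact: closed_ge].
by apply/seteqP; split=> v /=; rewrite subr_ge0.
Qed.

Let closed_eq_cont (f g : row -> R) : continuous f -> continuous g ->
  closed [set v | f v = g v].
Proof.
move=> cf cg.
rewrite (_ : [set _ | _] = [set v | f v <= g v] `&` [set v | g v <= f v]).
  by apply: closedI; exact: closed_le_cont.
apply/seteqP; split=> v /= => [->//|[a b]].
by apply/eqP; rewrite eq_le a b.
Qed.

Let closed_all (I : Type) (Q : I -> row -> Prop) :
  (forall i, closed [set v | Q i v]) -> closed [set v | forall i, Q i v].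
Proof.
move=> cQ; rewrite (_ : [set _ | _] = \bigcap_(i in setT) [set v | Q i v]).
  by apply: closed_bigI => i _; exact: cQ.
by apply/seteqP; split=> v /=; [move=> h i _; exact: h|move=> h i; exact: h].
Qed.

Let A : set row := [set v | admissible E Pi (vec_mx v)].

Let closedA : closed A.
Proof.
rewrite (_ : A = [set v | forall i j, 0 <= vec_mx v i j] `&`
  [set v | forall j, \sum_i vec_mx v i j = 1] `&`
  [set v | forall X t W (_ : is_dist X), mass (vec_mx v ^+ t.+1 *m X) W <=
    mass (vec_mx v ^+ t *m X) W + mass (vec_mx v ^+ t *m X) (neighborhood E W)]
  `&` [set v | forall i, (vec_mx v *m Pi) i ord0 = Pi i ord0]).
  apply: closedI; first apply: closedI; first apply: closedI.
  - do 2! (apply: closed_all => ?).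
    by apply: closed_le_cont; [exact: cst_continuous|exact: cont_entry].
  - apply: closed_all => j; apply: closed_eq_cont; last exact: cst_continuous.
    by apply: cont_sum => i; exact: cont_entry.
  - do 4! (apply: closed_all => ?).
    apply: closed_le_cont; first exact: cont_mass_exp.
    by move=> v; exact: (cvgD (@cont_mass_exp _ _ _ v) (@cont_mass_exp _ _ _ v)).
  - apply: closed_all => i; apply: closed_eq_cont; last exact: cst_continuous.
    by apply: cont_mulmx; [exact: cont_entry|exact: cont_cst_mx].
apply/seteqP; split=> v /=.
  by case=> -[h0 h1] hl hP; split; [split|] => // i; rewrite hP.
case=> -[[h0 h1] hl] hP; split => //.
by apply/matrixP => i j; rewrite ord1; exact: hP.
Qed.

Let compactA : compact A.
Proof.
have := @rV_compact R^o (n * n) (fun=> `[0, 1]%classic) (fun=> @segment_compact _ 0 1).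
move=> /(subclosed_compact closedA); apply=> v [[h0 h1] _ _] k /=.
case/mxvec_indexP: k => i j.
have -> : v ord0 (mxvec_index i j) = vec_mx v i j by rewrite mxE.
rewrite in_itv/= h0/= -(h1 j) (bigD1 i)//= lerDl.
by apply: sumr_ge0.
Qed.

Let nonemptyA : A (mxvec 1%:M).
Proof.
rewrite /A/= mxvecK; split; last by rewrite mul1mx.
- split=> [i j|j]; first by rewrite mxE ler0n.
  rewrite (bigD1 j)//= mxE eqxx big1 ?addr0// => i ij.
  by rewrite mxE (negbTE ij).
- move=> X t W [X0 _]; rewrite /matrix_system.
  have -> m : (1%:M : 'M[R]_n) ^+ m = 1%:M.
    by elim: m => // m IH; rewrite exprS IH; exact: mul1mx.
  rewrite (_ : (1%:M : 'M[R]_n) ^+ t = 1%:M); last first.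
    by elim: t => // m IH; rewrite exprS IH; exact: mul1mx.
  by rewrite mul1mx lerDl; apply: sumr_ge0.
Qed.

Lemma conductance_max : exists2 P, admissible E Pi P &
  conductance E Pi = conductance_of Pi P.
Proof.
pose Q (W : {set V}) := 0 < mass Pi W <= 2^-1.
pose g W (v : row) := mass (vec_mx v *m cond_dist Pi W) (~: W).
suff [v Av vmax] : exists2 v, A v &
    forall w, A w -> (conductance_of Pi (vec_mx w) <= conductance_of Pi (vec_mx v))%E.
  exists (vec_mx v) => //; apply/eqP; rewrite eq_le; apply/andP; split.
    apply: ge_ereal_sup => _ [P aP <-]; rewrite -(mxvecK P); apply: vmax.
    by rewrite /A/= mxvecK.
  by apply: ereal_sup_ubound; exists (vec_mx v).
have [[W0 QW0]|noQ] := pselect (exists W, Q W); last first.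
  exists (mxvec 1%:M) => // w _; rewrite /conductance_of !big1 => // [W QW|W QW].
    by exfalso; apply: noQ; exists W.
  by exfalso; apply: noQ; exists W.
pose f v := \big[Order.min/g W0 v]_(W | Q W) g W v.
have condE v : conductance_of Pi (vec_mx v) = (f v)%:E.
  apply/eqP; rewrite eq_le; apply/andP; split; last first.
    apply: le_bigmin; first exact: leey.
    by move=> W QW; rewrite lee_fin; exact: bigmin_le_cond.
  rewrite /f; elim/big_ind : _ => [|x y hx hy|W QW].
  - exact: (bigmin_le_cond _ (fun W => (g W v)%:E)).
  - by rewrite EFin_min le_min hx.
  - exact: (bigmin_le_cond _ (fun W => (g W v)%:E)).
have cg W : continuous (g W).
  by apply: cont_mass => i j; apply: cont_mulmx; [exact: cont_entry|exact: cont_cst_mx].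
have cf : continuous f.
  rewrite /f; elim: (index_enum _) => [|W r IH].
    by under eq_fun do rewrite big_nil; exact: cg.
  under eq_fun do rewrite big_cons.
  by case: (Q W) => // x; apply: (@continuous_min _ _ (g W)); [exact: cg|exact: IH].
have [v Av vmax] := compact_EVT_max (ex_intro _ _ nonemptyA) compactA
  (continuous_subspaceT cf).
exists v; first by rewrite inE in Av.
by move=> w Aw; rewrite !condE lee_fin; apply: vmax; rewrite inE.
Qed.

End conductance_max.

(* Main.v *)
(* By locality and a real-valued version of Hall's theorem, each step of the
   trajectory started at a node l is realized by a flow along the edges.  The
   average of these flows with weights Pi l over l, and uniform weights over the
   first tau steps, is by linearity and invariance a flow from Pi to Pi, hence
   comes from a local stochastic matrix P which preserves Pi.  If Pi(W) <= 1/2,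
   then at time tau at least 1/4 of the mass started from Pi | W lies outside W;
   it crossed from W to its complement along the flows, so that Phi(P) is at
   least 1/(4 tau).  If tau = 0 there is no such W, and the conductance is +oo. *)

From mathcomp Require Import all_boot all_order all_algebra.
From mathcomp Require Import all_classical all_reals all_analysis.
From mathcomp Require Import fintype finset lra.
Require Import Defs.

Import Order.TTheory GRing.Theory Num.Theory.
Import numFieldNormedType.Exports.

Local Open Scope ring_scope.

(** * Hall's theorem for real masses *)

(** Unlike in [neighborhood], the nodes of [W] are not excluded: with loops at all nodes this is [W]
    together with its neighborhood. *)
Definition sources {V : finType} (E : rel V) (W : {set V}) : {set V} :=
  [set i | [exists j in W, E i j]].

Lemma sourcesP {V : finType} (E : rel V) (W : {set V}) (i : V) :
  reflect (exists2 j, j \in W & E i j) (i \in sources E W).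
Proof. by rewrite inE; apply: exists_inP. Qed.

Lemma sumr_setUI {R : realFieldType} {V : finType} (f : V -> R) (A B : {set V}) :
  \sum_(i in A :|: B) f i + \sum_(i in A :&: B) f i
  = \sum_(i in A) f i + \sum_(i in B) f i.
Proof.
rewrite !(big_mkcond (fun i => i \in _)) -!big_split; apply: eq_bigr => i _ /=.
by rewrite !inE; case: (i \in A); case: (i \in B) => /=; lra.
Qed.

Lemma ler_sum_subset {R : realFieldType} {V : finType} (f : V -> R)
    (A B : {set V}) :
  (forall i, 0 <= f i) -> A \subset B -> \sum_(i in A) f i <= \sum_(i in B) f i.
Proof.
move=> f0 /subsetP AB; rewrite !(big_mkcond (fun i => i \in _)).
apply: ler_sum => i _; have := AB i.
by case: (i \in A) => [->|_]//; case: ifP.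
Qed.

Lemma sumrB1 {R : realFieldType} {V : finType} (f : V -> R) (i : V) (e : R)
    (A : {set V}) :
  \sum_(k in A) (f k - (if k == i then e else 0))
  = \sum_(k in A) f k - (if i \in A then e else 0).
Proof.
rewrite sumrB; congr (_ - _).
rewrite -big_mkcondr /=; case: ifP => iA.
  by rewrite (big_pred1 i)// => k /=; case: eqP => [->|]; rewrite ?iA ?andbT ?andbF.
by rewrite big_pred0// => k /=; case: eqP => [->|]; rewrite ?iA ?andbF.
Qed.

(* Hall's theorem for real masses, by induction on the number of edges: some
   amount e can be sent along a given edge (i, j) so that Hall's condition
   survives the deletion of this edge.  The deletion bounds e from below, the
   removal of e from a i bounds it from above, and submodularity of
   W |-> a (sources E W) makes these bounds compatible. *)
Lemma transport {R : realFieldType} {V : finType} (E : rel V) (a b : V -> R) :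
  (forall i, 0 <= a i) -> (forall j, 0 <= b j) ->
  (forall W : {set V}, \sum_(j in W) b j <= \sum_(i in sources E W) a i) ->
  exists F : V -> V -> R, [/\ forall j i, 0 <= F j i,
    forall j i, ~~ E i j -> F j i = 0,
    forall j, \sum_i F j i = b j & forall i, \sum_j F j i <= a i].
Proof.
have [n] := ubnP #|[set p : V * V | E p.1 p.2]|.
elim: n => // n IH in E a b *.
rewrite ltnS => En a0 b0 hall.
have [[i j] /= Eij|noE] := pickP [pred p : V * V | E p.1 p.2]; last first.
  have b_eq0 j : b j = 0.
    apply/eqP; rewrite eq_le b0 andbT; have := hall [set j].
    rewrite big_set1 big_pred0// => i; apply/negP => /sourcesP[k _ Eik].
    by have := noE (i, k); rewrite /= Eik.
  exists (fun _ _ => 0); split => // [j|i]; first by rewrite big1.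
  by rewrite big1.
pose E' : rel V := [rel x y | E x y && ((x, y) != (i, j))].
(* Deleting [(i, j)] changes the sources only of sets containing [j], and the only source they can
   lose is [i]. *)
have srcU (W : {set V}) : j \in W -> sources E W = i |: sources E' W.
  move=> jW; apply/setP => k; rewrite in_setU1; apply/sourcesP/orP.
    case=> l lW Ekl; have [[-> _]|ne] := (k, l) =P (i, j); first by left.
    by right; apply/sourcesP; exists l => //; rewrite /E' /= Ekl; apply/eqP.
  case=> [/eqP->|/sourcesP[l lW /andP[Ekl _]]]; first by exists j.
  by exists l.
have srcN (W : {set V}) : j \notin W -> sources E W = sources E' W.
  move=> jW; apply/setP => k; apply/sourcesP/sourcesP => -[l lW].
    move=> Ekl; exists l => //; rewrite /E' /= Ekl; apply/eqP => -[_ lj].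
    by rewrite -lj lW in jW.
  by case/andP; exists l.
pose A (W : {set V}) := \sum_(k in sources E' W) a k.
pose B (W : {set V}) := \sum_(k in W) b k.
have hallN (W : {set V}) : j \notin W -> B W <= A W by move=> jW; rewrite /A -srcN//; exact: hall.
have hallU (W : {set V}) : j \in W -> i \notin sources E' W -> B W <= a i + A W.
  by move=> jW iW; rewrite /A -big_setU1//= -srcU//; exact: hall.
have hallT (W : {set V}) : j \in W -> i \in sources E' W -> B W <= A W.
  move=> jW iW; rewrite /A; have := hall W.
  by rewrite srcU// (setUidPr _)// sub1set.
(* The least amount compatible with Hall's condition on the sets that contain [j] and lose the
   source [i]; the default 0 keeps it nonnegative. *)
pose e := \big[Num.max/0]_(U : {set V} | (j \in U) && (i \notin sources E' U))
  (B U - A U).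
have e0 : 0 <= e by exact: bigmax_ge_id.
have eU (U : {set V}) : j \in U -> i \notin sources E' U -> B U - A U <= e.
  by move=> jU iU; apply: (le_bigmax_cond _ (fun U => B U - A U)); rewrite jU.
have ea : e <= a i.
  apply: bigmax_le => // U /andP[jU iU].
  by rewrite lerBlDr hallU.
(* Hall's condition for [U] without [j] already accounts for all of [B U] except [b j]. *)
have eb : e <= b j.
  apply: bigmax_le => // U /andP[jU iU].
  have -> : B U = b j + B (U :\ j) by rewrite /B (big_setD1 j).
  rewrite -addrA gerDl subr_le0 (le_trans (hallN _ _)) ?setD11//.
  apply: ler_sum_subset => //; apply/subsetP => k /sourcesP[l].
  by rewrite in_setD1 => /andP[_ lU] E'kl; apply/sourcesP; exists l.
(* Hall's condition survives the deletion for [U :&: W], which avoids [j], and for [U :|: W], which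
   keeps the source [i]. *)
have eN (W : {set V}) : j \notin W -> i \in sources E' W -> e <= A W - B W.
  move=> jW iW; apply: bigmax_le => [|U /andP[jU iU]].
    by rewrite subr_ge0 hallN.
  have hUI : B (U :&: W) <= \sum_(k in sources E' U :&: sources E' W) a k.
    apply: le_trans (hallN _ _) _; first by rewrite inE (negbTE jW) andbF.
    apply: ler_sum_subset => //; apply/subsetP => k /sourcesP[l].
    rewrite !inE => /andP[lU lW] E'kl.
    by apply/andP; split; apply/exists_inP; exists l.
  have hUU : B (U :|: W) <= \sum_(k in sources E' U :|: sources E' W) a k.
    apply: le_trans (hallT _ _ _) _.
    - by rewrite inE jU.
    - case/sourcesP: iW => l lW E'il; apply/sourcesP; exists l => //.
      by rewrite inE lW orbT.
    apply: ler_sum_subset => //; apply/subsetP => k /sourcesP[l].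
    rewrite inE => /orP[lU|lW] E'kl; rewrite inE; apply/orP; [left|right];
      by apply/sourcesP; exists l.
  have := sumr_setUI b U W; have := sumr_setUI a (sources E' U) (sources E' W).
  rewrite -/(B U) -/(B W) -/(B _) -/(B _) -/(A U) -/(A W); lra.
pose a' k := a k - (if k == i then e else 0).
pose b' k := b k - (if k == j then e else 0).
have [||||F [F0 FE Fb Fa]] := IH E' a' b'.
- rewrite (leq_trans _ En)//; apply: proper_card; apply/properP; split.
    by apply/subsetP => p; rewrite !inE => /andP[].
  by exists (i, j); rewrite !inE //= /E' /= eqxx andbF.
- by move=> k; rewrite /a'; case: eqP => [->|_]; rewrite subr_ge0.
- by move=> k; rewrite /b'; case: eqP => [->|_]; rewrite subr_ge0.
- move=> W; rewrite !sumrB1 -/(A W) -/(B W).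
  (* The demand of [W] drops by [e] when [j] is in [W], the supply when [i] is a source of [W]; the
     mixed cases are the lower bound [eU] and the upper bound [eN]. *)
  have [jW|jW] := boolP (j \in W); have [iW|iW] := boolP (i \in sources E' W).
  + by have := hallT W jW iW; lra.
  + by have := eU W jW iW; lra.
  + by have := eN W jW iW; lra.
  + by have := hallN W jW; lra.
pose D l k := if (l == j) && (k == i) then e else 0.
have sumD (s : V) : (\sum_x (if (x == s) then e else 0)) = e.
  by rewrite -big_mkcond big_pred1_eq.
exists (fun l k => F l k + D l k); split.
- by move=> l k; rewrite addr_ge0// /D; case: ifP.
- move=> l k nE; rewrite FE ?/E' /= ?(negbTE nE)// add0r /D.
  by case: andP => // -[/eqP lj /eqP ki]; rewrite lj ki Eij in nE.
- move=> l; rewrite big_split /= Fb /b' /D; case: eqP => _ /=.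
    by rewrite sumD subrK.
  by rewrite big1// subr0 addr0.
- move=> k; rewrite big_split /=; have := Fa k; rewrite /a' /D.
  case: eqP => _ /=; last by rewrite subr0 [X in _ + X]big1 ?addr0// => l _; rewrite andbF.
  have -> : \sum_x (if (x == j) && true then e else 0) = e.
    by under eq_bigr do rewrite andbT; exact: sumD.
  by rewrite lerBrDr.
Qed.

(** * Flows along the edges *)

(* F j i is the mass moved from i to j. *)
Definition is_flow {R : realType} {V : finType} (E : rel V) (a b : V -> R)
    (F : V -> V -> R) : Prop :=
  [/\ forall j i, 0 <= F j i, forall j i, ~~ E i j -> F j i = 0,
      forall j, \sum_i F j i = b j & forall i, \sum_j F j i = a i].

(** With loops, the sources of [W] include the disjoint sets [W] and [neighborhood E W], so locality
    gives Hall's condition. Equal totals turn the capacity bound of [transport] into an equality. *)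
Lemma local_flow {R : realType} {V : finType} (E : rel V) (a b : V -> R) :
  (forall i, E i i) -> (forall i, 0 <= a i) -> (forall j, 0 <= b j) ->
  \sum_i a i = \sum_j b j ->
  (forall W : {set V}, \sum_(j in W) b j <=
    \sum_(i in W) a i + \sum_(i in neighborhood E W) a i) ->
  exists F, is_flow E a b F.
Proof.
move=> Err a0 b0 ab hloc.
have [|F [F0 FE Fb Fa]] := transport E a b a0 b0.
  move=> W; apply: le_trans (hloc W) _; rewrite -sumr_setUI.
  have -> : W :&: neighborhood E W = set0.
    by apply/setP => i; rewrite !inE; case: (i \in W).
  rewrite big_set0 addr0.
  apply: ler_sum_subset => //; apply/subsetP => i; rewrite !inE => /orP[iW|].
    by apply/exists_inP; exists i.
  by case/andP.
exists F; split => // i; apply/eqP; have aF k : true -> 0 <= a k - \sum_j F j k.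
  by rewrite subr_ge0.
have : \sum_k (a k - \sum_j F j k) == 0.
  by rewrite sumrB exchange_big/= ab (eq_bigr _ (fun j _ => Fb j)) subrr.
by rewrite psumr_eq0// => /allP/(_ i (mem_index_enum i)); rewrite /= subr_eq0 eq_sym.
Qed.

Lemma flow_sum {R : realType} {V I : finType} (E : rel V) (w : I -> R)
    (a b : I -> V -> R) (F : I -> V -> V -> R) :
  (forall l, 0 <= w l) -> (forall l, is_flow E (a l) (b l) (F l)) ->
  is_flow E (fun i => \sum_l w l * a l i) (fun j => \sum_l w l * b l j)
    (fun j i => \sum_l w l * F l j i).
Proof.
move=> w0 FF; split.
- by move=> j i; apply: sumr_ge0 => l _; rewrite mulr_ge0//; case: (FF l).
- move=> j i nE; apply: big1 => l _.
  by case: (FF l) => _ -> //; rewrite mulr0.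
- move=> j; rewrite exchange_big; apply: eq_bigr => l _.
  by rewrite -mulr_sumr; case: (FF l) => _ _ ->.
- move=> i; rewrite exchange_big; apply: eq_bigr => l _.
  by rewrite -mulr_sumr; case: (FF l) => _ _ _ ->.
Qed.

(** Mass ending outside [W] came from [W] or was outside already, and the latter part is at most the
    initial mass there. *)
Lemma flow_escape {R : realType} {V : finType} (E : rel V) (a b : V -> R)
    (F : V -> V -> R) (W : {set V}) :
  is_flow E a b F ->
  \sum_(j in ~: W) b j - \sum_(j in ~: W) a j
  <= \sum_(j in ~: W) \sum_(i in W) F j i.
Proof.
move=> [F0 _ Fb Fa]; rewrite lerBlDr.
under eq_bigr do rewrite -Fb (bigID (mem W))/=.
rewrite big_split/= lerD2l exchange_big/=.
rewrite [leRHS](eq_bigl (fun j => j \notin W)); last by move=> j; rewrite inE.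
apply: ler_sum => i _; rewrite -Fa [leRHS](bigID (mem (~: W)))/= lerDl.
exact: sumr_ge0.
Qed.

(** * Distributions as column vectors *)

Lemma coord_sum {R : realType} {V I : finType} (f : I -> 'cV[R]_#|V|) (k : V) :
  coord (\sum_i f i) k = \sum_i coord (f i) k.
Proof. by rewrite /coord summxE. Qed.

Lemma coordZ {R : realType} {V : finType} (c : R) (X : 'cV[R]_#|V|) (k : V) :
  coord (c *: X) k = c * coord X k.
Proof. by rewrite /coord mxE. Qed.

Lemma coordP {R : realType} {V : finType} (X Y : 'cV[R]_#|V|) :
  coord X =1 coord Y -> X = Y.
Proof.
by move=> XY; apply/colP => k; have := XY (enum_val k); rewrite /coord enum_valK.
Qed.

Lemma massT {R : realType} {V : finType} (X : 'cV[R]_#|V|) :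
  mass X [set: V] = \sum_i coord X i.
Proof. by apply: eq_bigl => i; rewrite inE. Qed.

Lemma coord_cond_dist {R : realType} {V : finType} (X : 'cV[R]_#|V|)
    (W : {set V}) (i : V) :
  coord (cond_dist X W) i = if i \in W then coord X i / mass X W else 0.
Proof. by rewrite /coord mxE enum_rankK. Qed.

Lemma cond_dist_is_dist {R : realType} {V : finType} (X : 'cV[R]_#|V|)
    (W : {set V}) : is_dist X -> 0 < mass X W -> is_dist (cond_dist X W).
Proof.
move=> [X0 _] XW; split=> [i|].
  by rewrite coord_cond_dist; case: ifP => // _; rewrite divr_ge0// ltW.
rewrite massT; under eq_bigr do rewrite coord_cond_dist.
by rewrite -big_mkcond/= -mulr_suml divff// gt_eqF.
Qed.

(** Both totals are 1, so the differences on [W] and on its complement cancel, and each is at most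
    half the norm in absolute value. *)
Lemma mass_le_l1 {R : realType} {V : finType} (X Y : 'cV[R]_#|V|) (W : {set V}) :
  is_dist X -> is_dist Y -> mass Y W - mass X W <= l1_norm (X - Y) / 2.
Proof.
move=> [_ X1] [_ Y1].
have dE i : coord (X - Y) i = coord X i - coord Y i by rewrite /coord !mxE.
have hW (A : {set V}) :
    `|mass Y A - mass X A| <= \sum_(i in A) `|coord (X - Y) i|.
  rewrite /mass -sumrB; apply: le_trans (ler_norm_sum _ _ _) _.
  by apply: ler_sum => i _; rewrite dE distrC.
have split_sum (f : V -> R) :
    \sum_i f i = \sum_(i in W) f i + \sum_(i in ~: W) f i.
  rewrite (bigID (mem W))/=; congr (_ + _).
  by apply: eq_bigl => i; rewrite inE.
move: X1 Y1; rewrite !massT !split_sum -!/(mass _ _) => X1 Y1.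
rewrite ler_pdivlMr// /l1_norm split_sum.
have := hW W; have := hW (~: W); rewrite !ler_norml; lra.
Qed.

(** * Decomposition of trajectories by starting node *)

Definition dirac_vec {R : realType} {V : finType} (i : V) : 'cV[R]_#|V| :=
  \col_k (enum_val k == i)%:R.

Lemma coord_dirac_vec {R : realType} {V : finType} (i k : V) :
  coord (@dirac_vec R V i) k = (k == i)%:R.
Proof. by rewrite /coord mxE enum_rankK. Qed.

Lemma dirac_vec_is_dist {R : realType} {V : finType} (i : V) :
  is_dist (@dirac_vec R V i).
Proof.
split=> [k|]; first by rewrite coord_dirac_vec.
rewrite massT (bigD1 i)//= coord_dirac_vec eqxx big1 ?addr0// => k ki.
by rewrite coord_dirac_vec (negbTE ki).
Qed.

Lemma conv_is_dist {R : realType} {V : finType} (X Y : 'cV[R]_#|V|) (p : R) :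
  is_dist X -> is_dist Y -> 0 <= p <= 1 -> is_dist (p *: X + (1 - p) *: Y).
Proof.
move=> [X0 X1] [Y0 Y1] /andP[p0 p1].
have cE i : coord (p *: X + (1 - p) *: Y) i = p * coord X i + (1 - p) * coord Y i.
  by rewrite /coord !mxE.
split=> [i|]; first by rewrite cE addr_ge0// mulr_ge0// subr_ge0.
rewrite massT; under eq_bigr do rewrite cE.
by rewrite big_split/= -!mulr_sumr -!massT X1 Y1; lra.
Qed.

(** Induction on the list: the tail, rescaled by its total weight [s], is again a convex
    combination, and two-point linearity joins it to the head. Linearity asks for distributions, so
    that property is carried along. *)
Lemma linear_system_conv {R : realType} {V I : finType} (S : sys R V) (t : nat)
    (Y : I -> 'cV[R]_#|V|) :
  linear_system S -> (forall i, is_dist (Y i)) ->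
  forall (r : seq I) (w : I -> R), (forall i, 0 <= w i) ->
    \sum_(i <- r) w i = 1 ->
    is_dist (\sum_(i <- r) w i *: Y i) /\
    S (\sum_(i <- r) w i *: Y i) t = \sum_(i <- r) w i *: S (Y i) t.
Proof.
move=> hlin Yd; elim=> [|i r IH] w w0.
  by rewrite big_nil => /esym/eqP; rewrite oner_eq0.
rewrite !big_cons; set s := \sum_(j <- r) w j => w1.
have s0 : 0 <= s by exact: sumr_ge0.
(* Rescaling by [s] is impossible if [s] is 0, but then all weights of the tail vanish. *)
have [s_eq0|s_neq0] := eqVneq s 0.
  have wi1 : w i = 1 by rewrite -w1 s_eq0 addr0.
  have wr0 (Z : I -> 'cV[R]_#|V|) : \sum_(j <- r) w j *: Z j = 0.
    apply: big1_seq => j /andP[_ jr].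
    move/eqP: s_eq0; rewrite psumr_eq0// => /allP/(_ j jr)/eqP->.
    by rewrite scale0r.
  by rewrite !wr0 !addr0 wi1 !scale1r.
have sE : s = 1 - w i by rewrite -w1 addrC addKr.
have [||dr Sr] := IH (fun j => w j / s).
- by move=> j; rewrite divr_ge0.
- by rewrite -mulr_suml divff.
have rE (Z : I -> 'cV[R]_#|V|) :
    \sum_(j <- r) w j *: Z j = s *: \sum_(j <- r) (w j / s) *: Z j.
  by rewrite scaler_sumr; apply: eq_bigr => j _; rewrite scalerA mulrC divfK.
have p01 : 0 <= w i <= 1 by rewrite w0 -subr_ge0 -sE.
rewrite !rE; split; rewrite {1}sE; first exact: conv_is_dist.
by rewrite hlin// Sr -sE.
Qed.

Lemma linear_system_dirac {R : realType} {V : finType} (S : sys R V)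
    (X : 'cV[R]_#|V|) (t : nat) (k : V) :
  linear_system S -> is_dist X ->
  coord (S X t) k = \sum_i coord X i * coord (S (dirac_vec i) t) k.
Proof.
move=> hlin [X0]; rewrite massT => X1.
have [_] := linear_system_conv S t dirac_vec hlin dirac_vec_is_dist _ _ X0 X1.
have <- : X = \sum_i coord X i *: dirac_vec i.
  apply: coordP => j; rewrite coord_sum (bigD1 j)//= coordZ coord_dirac_vec eqxx.
  rewrite mulr1 big1 ?addr0// => i ij.
  by rewrite coordZ coord_dirac_vec eq_sym (negbTE ij) mulr0.
by move=> ->; rewrite coord_sum; apply: eq_bigr => i _; rewrite coordZ.
Qed.

(** * Stochastic matrices from kernels and flows *)

Definition kernel_mx {R : realType} {V : finType} (K : V -> V -> R) :
  'M[R]_#|V| := \matrix_(k, l) K (enum_val k) (enum_val l).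

Lemma coord_kernel_mx {R : realType} {V : finType} (K : V -> V -> R)
    (X : 'cV[R]_#|V|) (j : V) :
  coord (kernel_mx K *m X) j = \sum_i K j i * coord X i.
Proof.
rewrite /coord mxE (reindex enum_rank)/=; last exact/onW_bij/enum_rank_bij.
by apply: eq_bigr => i _; rewrite mxE !enum_rankK.
Qed.

Lemma kernel_mx_is_dist {R : realType} {V : finType} (K : V -> V -> R)
    (X : 'cV[R]_#|V|) :
  (forall j i, 0 <= K j i) -> (forall i, \sum_j K j i = 1) ->
  is_dist X -> is_dist (kernel_mx K *m X).
Proof.
move=> K0 K1 [X0]; rewrite massT => X1; split=> [i|].
  by rewrite coord_kernel_mx sumr_ge0// => j _; rewrite mulr_ge0.
rewrite massT; under eq_bigr do rewrite coord_kernel_mx.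
rewrite exchange_big/= -[RHS]X1; apply: eq_bigr => i _.
by rewrite -mulr_suml K1 mul1r.
Qed.

(** The powers keep [X] a distribution, so one step suffices: a node sends into [W] at most its own
    mass, and nothing if it has no edge into [W]. *)
Lemma kernel_mx_local {R : realType} {V : finType} (E : rel V)
    (K : V -> V -> R) :
  (forall j i, 0 <= K j i) -> (forall i, \sum_j K j i = 1) ->
  (forall j i, ~~ E i j -> K j i = 0) ->
  local_matrix E (kernel_mx K).
Proof.
move=> K0 K1 KE X t W dX; rewrite /matrix_system.
have powS (s : nat) : kernel_mx K ^+ s.+1 *m X = kernel_mx K *m (kernel_mx K ^+ s *m X).
  by rewrite exprS mulmxA.
have [Y0 _] : is_dist (kernel_mx K ^+ t *m X).
  elim: t => [|t IH]; first by rewrite expr0 mul1mx.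
  by rewrite powS; exact: kernel_mx_is_dist.
rewrite powS; set Y := _ *m X in Y0 *.
rewrite {1}/mass; under eq_bigr do rewrite coord_kernel_mx.
rewrite exchange_big/= /mass -sumr_setUI addrC.
rewrite (_ : W :&: neighborhood E W = set0); last first.
  by apply/setP => i; rewrite !inE; case: (i \in W).
rewrite big_set0 add0r [leRHS]big_mkcond/=; apply: ler_sum => i _.
rewrite -mulr_suml; case: ifPn => [_|iN].
  rewrite -[leRHS]mul1r ler_wpM2r// -(K1 i) [leRHS](bigID (mem W))/= lerDl.
  exact: sumr_ge0.
rewrite big1 ?mul0r// => j jW; apply: KE; apply: contra iN => Eij.
by rewrite !inE -implyNb implybE; case: (i \in W) => //=; apply/exists_inP; exists j.
Qed.

(* At a node of mass 0, where the flow prescribes nothing, the kernel stays put;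
   this keeps it stochastic. *)
Definition flow_kernel {R : realType} {V : finType} (p : V -> R)
    (C : V -> V -> R) (j i : V) : R :=
  if p i == 0 then (j == i)%:R else C j i / p i.

Lemma flow_kernelM {R : realType} {V : finType} (E : rel V) (p : V -> R)
    (C : V -> V -> R) (j i : V) :
  is_flow E p p C -> flow_kernel p C j i * p i = C j i.
Proof.
move=> [C0 _ _ Ca]; rewrite /flow_kernel; case: eqVneq => [pi0|pi0].
  rewrite pi0 mulr0; apply/esym/eqP; move/eqP: (Ca i); rewrite pi0.
  by rewrite psumr_eq0// => /allP/(_ j (mem_index_enum j)).
by rewrite divfK.
Qed.

(** The outflow of each node is its mass under [Pi], so columns sum to one; the inflow is the same,
    so [Pi] is preserved. Loops make staying put at nodes of mass 0 local. *)
Lemma flow_kernel_admissible {R : realType} {V : finType} (E : rel V)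
    (Pi : 'cV[R]_#|V|) (C : V -> V -> R) :
  (forall i, E i i) -> (forall i, 0 <= coord Pi i) ->
  is_flow E (coord Pi) (coord Pi) C ->
  admissible E Pi (kernel_mx (flow_kernel (coord Pi) C)).
Proof.
move=> Err p0 hC; have [C0 CE Cb Ca] := hC.
have K0 j i : 0 <= flow_kernel (coord Pi) C j i.
  by rewrite /flow_kernel; case: ifP => // _; rewrite divr_ge0.
have K1 i : \sum_j flow_kernel (coord Pi) C j i = 1.
  rewrite /flow_kernel; case: eqVneq => [_|pi0].
    by rewrite (bigD1 i)//= eqxx big1 ?addr0// => j /negbTE->.
  by rewrite -mulr_suml Ca divff.
split.
- split=> [i j|j]; first by rewrite mxE.
  rewrite (reindex enum_rank)/=; last exact/onW_bij/enum_rank_bij.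
  by rewrite -[RHS](K1 (enum_val j)); apply: eq_bigr => i _; rewrite mxE enum_rankK.
- apply: kernel_mx_local => // j i nE; rewrite /flow_kernel.
  case: ifP => _; last by rewrite CE// mul0r.
  by case: eqVneq => // ji; rewrite ji Err in nE.
- apply: coordP => j; rewrite coord_kernel_mx -Cb.
  by apply: eq_bigr => i _; exact: flow_kernelM hC.
Qed.

Lemma mass_flow_kernel {R : realType} {V : finType} (E : rel V)
    (Pi : 'cV[R]_#|V|) (C : V -> V -> R) (W : {set V}) :
  is_flow E (coord Pi) (coord Pi) C ->
  mass (kernel_mx (flow_kernel (coord Pi) C) *m cond_dist Pi W) (~: W)
  = (\sum_(j in ~: W) \sum_(i in W) C j i) / mass Pi W.
Proof.
move=> hC; rewrite mulr_suml; apply: eq_bigr => j _.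
rewrite coord_kernel_mx mulr_suml [RHS]big_mkcond/=; apply: eq_bigr => i _.
rewrite coord_cond_dist; case: ifP => _; last by rewrite mulr0.
by rewrite mulrA (flow_kernelM _ _ _ _ _ hC).
Qed.

(** * The flow of the first [tau] steps *)

(** The flows are summed over time rather than averaged, which leaves the case [tau = 0]
    meaningful. *)
Lemma total_flow {R : realType} {V : finType} (E : rel V) (S : sys R V)
    (Pi : 'cV[R]_#|V|) (tau : nat) :
  (forall i, E i i) -> is_system S -> linear_system S -> local_system E S ->
  is_dist Pi -> (forall t, S Pi t = Pi) ->
  (forall X0, is_dist X0 -> l1_norm (S X0 tau - Pi) <= 2^-1) ->
  exists2 G, is_flow E (coord (tau%:R *: Pi)) (coord (tau%:R *: Pi)) G &
    forall W, 0 < mass Pi W <= 2^-1 ->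
      mass Pi W / 4 <= \sum_(j in ~: W) \sum_(i in W) G j i.
Proof.
move=> Err hS hlin hloc dPi hinv hmix; have [Pi0 Pi1] := dPi.
pose Y l t := coord (S (dirac_vec l) t) : V -> R.
have dY l t : is_dist (S (dirac_vec l) t).
  by have [_] := hS _ (@dirac_vec_is_dist R V l); exact.
have /choice[F hF] : forall q : V * 'I_tau,
    exists F, is_flow E (Y q.1 q.2) (Y q.1 q.2.+1) F.
  move=> q.
  have [[a0 a1] [b0 b1]] := (dY q.1 q.2, dY q.1 q.2.+1).
  apply: local_flow => //; first by rewrite -!massT a1 b1.
  by move=> W; apply: hloc; exact: dirac_vec_is_dist.
pose G j i := \sum_(q : V * 'I_tau) coord Pi q.1 * F q j i.
(* Taken with [s] the identity for departures and the successor for arrivals: by linearity and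
   invariance each time contributes [Pi]. *)
have sumPi (s : nat -> nat) k :
    \sum_(q : V * 'I_tau) coord Pi q.1 * Y q.1 (s q.2) k = coord (tau%:R *: Pi) k.
  rewrite -(pair_bigA _ (fun l t => coord Pi l * Y l (s (nat_of_ord t)) k))/=.
  rewrite exchange_big/=.
  under eq_bigr do rewrite -(linear_system_dirac S Pi _ k hlin dPi) hinv.
  by rewrite sumr_const card_ord coordZ mulr_natl.
have GG := flow_sum E (fun q : V * 'I_tau => coord Pi q.1) _ _ _ (fun q => Pi0 q.1) hF.
exists G.
  case: GG => g0 gE gb ga; split => // i.
  - by rewrite gb (sumPi succn).
  - by rewrite ga (sumPi id).
move=> W /andP[W0 W2].
have dW := cond_dist_is_dist _ _ dPi W0.
have mass_compl : 2^-1 <= mass Pi (~: W).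
  have : mass Pi W + mass Pi (~: W) = 1.
    rewrite -Pi1 massT (bigID (mem W))/=; congr (_ + _).
    by apply: eq_bigl => i; rewrite inE.
  lra.
(* The complement has mass at least 1/2 under [Pi], and an l1 distance of at most 1/2 lowers it by
   at most 1/4. *)
have quarter : 4^-1 <= mass (S (cond_dist Pi W) tau) (~: W).
  have [_ /(_ tau) dS] := hS _ dW.
  have := mass_le_l1 _ _ (~: W) dS dPi; have := hmix _ dW; lra.
(* The gains outside [W] in the single steps telescope. *)
have escape l : \sum_(j in ~: W) Y l tau j - \sum_(j in ~: W) Y l 0%N j
    <= \sum_(t < tau) \sum_(j in ~: W) \sum_(i in W) F (l, t) j i.
  rewrite -(telescope_sumr (fun t => \sum_(j in ~: W) Y l t j))// big_mkord.
  by apply: ler_sum => t _; exact: flow_escape (hF (l, t)).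
have start l : l \in W -> \sum_(j in ~: W) Y l 0%N j = 0.
  move=> lW; apply: big1 => j; rewrite inE => jW.
  have [S0 _] := hS _ (@dirac_vec_is_dist R V l).
  rewrite /Y S0 coord_dirac_vec; case: eqVneq => // jl.
  by rewrite jl lW in jW.
(* The intermediate quantity is the mass of [Pi] that starts in [W] and is outside at time [tau]. *)
apply: (@le_trans _ _ (\sum_(l in W) coord Pi l * \sum_(j in ~: W) Y l tau j)).
  have -> : \sum_(l in W) coord Pi l * \sum_(j in ~: W) Y l tau j =
      mass Pi W * mass (S (cond_dist Pi W) tau) (~: W).
    rewrite mulr_sumr; under eq_bigr do rewrite mulr_sumr.
    rewrite exchange_big/=; apply: eq_bigr => j _.
    rewrite (linear_system_dirac S _ _ _ hlin dW) mulr_sumr [LHS]big_mkcond/=.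
    apply: eq_bigr => l _; rewrite coord_cond_dist; case: ifP => _.
      by rewrite mulrA [_ * (_ / _)]mulrC divfK// gt_eqF.
    by rewrite mul0r mulr0.
  by rewrite ler_wpM2l// ltW.
have -> : \sum_(j in ~: W) \sum_(i in W) G j i = \sum_l coord Pi l *
    \sum_(t < tau) \sum_(j in ~: W) \sum_(i in W) F (l, t) j i.
  rewrite /G; under eq_bigr do rewrite exchange_big/=.
  rewrite exchange_big/=.
  under [RHS]eq_bigr do rewrite mulr_sumr.
  rewrite pair_bigA/=; apply: eq_bigr => -[l t] _ /=.
  rewrite mulr_sumr; apply: eq_bigr => j _.
  by rewrite mulr_sumr.
(* Starting nodes outside [W] only add nonnegative terms on the right. *)
rewrite big_mkcond/=; apply: ler_sum => l _; case: ifP => lW.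
  by rewrite ler_wpM2l//; have := escape l; rewrite start// subr0.
rewrite mulr_ge0//; apply: sumr_ge0 => t _; apply: sumr_ge0 => j _.
by apply: sumr_ge0 => i _; case: (hF (l, t)).
Qed.

(** * From the flow to the bound on [tau] *)

Local Open Scope classical_set_scope.

Theorem theorem1 (R : realType) (V : finType) (E : rel V) (S : sys R V)
    (Pi : 'cV[R]_#|V|) (tau : nat)
    (hE : forall i, E i i)
    (hS : is_system S)
    (hlin : linear_system S)
    (hloc : local_system E S)
    (hinv : invariant_system S)
    (hPi : is_dist Pi)
    (hconv : converges_to S Pi)
    (htau : forall (t : nat) (X0 : 'cV[R]_#|V|),
      (tau <= t)%N -> is_dist X0 -> l1_norm (S X0 t - Pi) <= 2^-1) :
  (1 / (8%:R%:E * conductance E Pi) <= tau%:R%:E)%E.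
Proof.
have [Pi0 _] := hPi.
have [G hG GW] := total_flow E S Pi tau hE hS hlin hloc hPi
  (hinv Pi hPi hconv) (fun X0 dX => htau tau X0 (leqnn tau) dX).
have [tau0|tau_gt0] := posnP tau.
  (* The flow now goes from 0 to 0 and vanishes, while [GW] would make a positive amount leave
     [W]. *)
  have noW (W : {set V}) : (0 < mass Pi W <= 2^-1) = false.
    apply/negP => hW; have := GW W hW; have [W0 _] := andP hW.
    have [g0 _ gb _] := hG; rewrite big1 => [|j _]; first lra.
    apply: big1 => i _; apply/eqP; rewrite eq_le g0 andbT.
    have := gb j; rewrite coordZ tau0 mul0r => <-.
    by rewrite (bigD1 i)//= lerDl sumr_ge0.
  have [P _ ->] := conductance_max E Pi.
  rewrite /conductance_of big_pred0//.
  by rewrite gt0_muley ?lte_fin// invey mule0 lee_fin.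
have t0 : 0 < tau%:R :> R by rewrite ltr0n.
pose C j i := tau%:R^-1 * G j i.
have hC : is_flow E (coord Pi) (coord Pi) C.
  have [g0 gE gb ga] := hG; split=> [j i|j i nE|j|i].
  - by rewrite mulr_ge0// invr_ge0 ltW.
  - by rewrite /C gE ?mulr0.
  - by rewrite -mulr_sumr gb coordZ mulKf// gt_eqF.
  - by rewrite -mulr_sumr ga coordZ mulKf// gt_eqF.
(* [GW] yields the bound 1/(4 tau), and half of it gives the constant 8. *)
have Phi_ge : ((8 * tau%:R)^-1%:E <= conductance E Pi)%E.
  apply: (@le_trans _ _ (conductance_of Pi (kernel_mx (flow_kernel (coord Pi) C)))).
    apply: le_bigmin => [|W hW]; first exact: leey.
    have [W0 _] := andP hW; rewrite lee_fin (mass_flow_kernel _ _ _ _ hC).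
    rewrite ler_pdivlMr//; under eq_bigr do rewrite -mulr_sumr.
    rewrite -mulr_sumr invfM mulrAC mulrC ler_pM2l ?invr_gt0//.
    by have := GW W hW; lra.
  apply: ereal_sup_ubound; exists (kernel_mx (flow_kernel (coord Pi) C)) => //.
  exact: flow_kernel_admissible.
(* [Phi_ge] rules out [-oo]; the value [+oo], reached if no [W] qualifies, makes the left side 0. *)
case: (conductance E Pi) Phi_ge => [r| |]//.
- rewrite lee_fin => rge.
  have r0 : 0 < r by apply: lt_le_trans rge; rewrite invr_gt0 mulr_gt0.
  rewrite -EFinM inver gt_eqF ?mulr_gt0// mul1e lee_fin.
  rewrite -(invrK tau%:R) lef_pV2 ?posrE ?invr_gt0 ?mulr_gt0//.
  move: rge; rewrite invfM; lra.
- by move=> _; rewrite gt0_muley ?lte_fin// invey mule0 lee_fin ler0n.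
Qed.
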